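(* Let $v\in\mathcal{S}_d$ be any pattern and fix an integer $\ell\ge 2$. For $n\in\mathbb{N}_0$ let $a_n:=\dfrac{g_0^v(\mathcal{S}_{n+d-1})}{(n+d-1)!}$, and let $$\beta_{\ell-1}(v):=a_{\ell-1}-a_\ell=\frac{g_0^v(\mathcal{S}_{\ell+d-2})}{(\ell+d-2)!}-\frac{g_0^v(\mathcal{S}_{\ell+d-1})}{(\ell+d-1)!}.$$ Then for every integer $n>\ell+2d$, $$0\le a_n-a_{n-1}+\beta_{\ell-1}(v)\,a_{n-\ell-d+1}\le \frac{d-1}{d!}\,a_{n-\ell-2d+2}.$$
   Context: $\mathcal{S}_m$ is the set of permutations of $\{1,\dots,m\}$ written as words $\sigma_1\cdots\sigma_m$. For $v\in\mathcal{S}_d$, a consecutive occurrence of $v$ in $\sigma$ is an index $j$, $1\le j\le m-d+1$, such that $\sigma_j\cdots\sigma_{j+d-1}$ is order-isomorphic to $v$ (i.e. $\sigma_{j+p-1}<\sigma_{j+q-1}\iff v_p<v_q$ for all $p,q$). $g_0^v(\mathcal{S}_m)$ is the number of $\sigma\in\mathcal{S}_m$ with no consecutive occurrence of $v$. *)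

(* Defs.v *)
From mathcomp Require Import all_boot all_order all_algebra all_fingroup.

Set Implicit Arguments.
Unset Strict Implicit.
Unset Printing Implicit Defensive.

Import Order.TTheory GRing.Theory Num.Theory.

(* Positions and values are numbered from 0 instead of 1; only the relative
   order of the values matters. *)
Definition word (m : nat) (s : 'S_m) : seq nat := [seq val (s i) | i : 'I_m].

Definition occurs_at (d : nat) (v : 'S_d) (m : nat) (s : 'S_m) (j : nat) : bool :=
  [forall p : 'I_d, forall q : 'I_d,
     (nth 0 (word s) (j + p) < nth 0 (word s) (j + q)) == (v p < v q)].

(* The positions j with j + d <= m are exactly the j < m.+1 - d; in particular
   there is none when m < d. *)
Definition avoids (d : nat) (v : 'S_d) (m : nat) (s : 'S_m) : bool :=
  ~~ [exists j : 'I_(m.+1 - d), occurs_at v s j].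

Definition g0 (d : nat) (v : 'S_d) (m : nat) : nat :=
  #|[set s : 'S_m | avoids v s]|.

Local Open Scope ring_scope.

(* n + d - 1 is the intended value only for 0 < d, because subtraction in nat
   is truncated. *)
Definition a (d : nat) (v : 'S_d) (n : nat) : rat :=
  (g0 v (n + d - 1))%:R / ((n + d - 1)`!)%:R.

Definition beta (d : nat) (v : 'S_d) (k : nat) : rat := a v k - a v k.+1.

(* Main.v *)
(* Take a uniform permutation of size M = n + d - 1. The relative orders on
   disjoint blocks of positions are independent, so beta_{l-1} a_{n-l-d+1} is
   the probability of G: the window n-1 is an occurrence, the l-1 windows
   before it are not, and neither are the first n-l-d+1 windows. Likewise
   a_{n-1} - a_n is the probability of F: the window n-1 is the first
   occurrence. As F implies G, the middle term of the theorem is the probability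
   of G without F. Then one of the d-1 windows j of the gap
   n-l-d+1 <= j < n-l is an occurrence, while the first n-l-2d+2 windows,
   disjoint from the window j, contain none; by independence each j
   contributes at most a_{n-l-2d+2} / d!. *)
Require Import Defs.
From mathcomp Require Import all_boot all_order all_algebra all_fingroup.
From mathcomp Require Import zify lra.

Import Order.TTheory GRing.Theory Num.Theory.
Local Open Scope ring_scope.

(** * Relative order of the entries at chosen positions *)

Lemma rank_lt {k m : nat} (h : 'I_k -> 'I_m) (s : 'S_m) (i : 'I_k) :
  (#|[pred j | s (h j) < s (h i)]| < k)%N.
Proof.
rewrite -[X in (_ < X)%N](card_ord k); apply: proper_card.
by apply/properP; split; [apply/subsetP | exists i; rewrite // inE ltnn].
Qed.

Definition rank {k m : nat} (h : 'I_k -> 'I_m) (s : 'S_m) (i : 'I_k) : 'I_k :=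
  Ordinal (rank_lt h s i).

Lemma ltn_rank {k m : nat} (h : 'I_k -> 'I_m) (s : 'S_m) (i j : 'I_k) :
  (rank h s i < rank h s j)%N = (s (h i) < s (h j))%N.
Proof.
have mono x y : (s (h x) <= s (h y))%N -> (rank h s x <= rank h s y)%N.
  move=> le_xy; apply: subset_leq_card; apply/subsetP=> z.
  by rewrite !inE => /leq_trans; apply.
case: (ltnP (s (h i))) => [lt_ij|/mono]; last by rewrite ltnNge => ->.
apply: proper_card; apply/properP; split.
  by apply/subsetP=> z; rewrite !inE => /ltn_trans; apply.
by exists i; rewrite inE ?ltnn.
Qed.

Lemma rank_inj {k m : nat} {h : 'I_k -> 'I_m} (h_inj : injective h) (s : 'S_m) :
  injective (rank h s).
Proof.
move=> i j eq_ij; apply/h_inj/(@perm_inj _ s)/val_inj/eqP.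
by case: ltngtP => //; rewrite -ltn_rank eq_ij ltnn.
Qed.

(** This is the standardization of the subword of [s] read at the positions [h]. *)
Definition pat {k m : nat} {h : 'I_k -> 'I_m} (h_inj : injective h) (s : 'S_m) :
  'S_k := perm (rank_inj h_inj s).

Lemma ltn_pat {k m : nat} {h : 'I_k -> 'I_m} (h_inj : injective h) (s : 'S_m)
    (i j : 'I_k) :
  (pat h_inj s i < pat h_inj s j)%N = (s (h i) < s (h j))%N.
Proof. by rewrite !permE ltn_rank. Qed.

(** The value of a permutation at [i] is the number of its smaller values, so the comparisons
    determine it. *)
Lemma perm_ltn_inj {k : nat} (s t : 'S_k) :
  (forall i j, (s i < s j)%N = (t i < t j)%N) -> s = t.
Proof.
have rankE (u : 'S_k) (i : 'I_k) : nat_of_ord (u i) = #|[pred j | u j < u i]%N|.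
  rewrite -(card_imset _ (@perm_inj _ u)) -sum1_card.
  transitivity (\sum_(x < k | x < u i) 1)%N.
    have := ltn_ord (u i); rewrite leq_eqVlt => /orP lt_uk.
    rewrite -(big_ord_widen k (fun=> 1%N)) ?sum1_card ?card_ord //.
    exact: ltnW.
  apply: eq_bigl => x; apply/idP/imsetP => [lt_x|[y]].
    by exists ((u^-1)%g x); rewrite ?inE permKV.
  by rewrite inE => lt_y ->.
move=> eq_st; apply/permP=> i; apply: val_inj; rewrite /= rankE [RHS]rankE.
by apply: eq_card => j; rewrite !inE.
Qed.

(* The permutation u of 'I_k, transported along h and extended by the identity. *)
Definition ext_fun {k m : nat} (h : 'I_k -> 'I_m) (u : 'S_k) (x : 'I_m) : 'I_m :=
  if [pick i | h i == x] is Some i then h (u i) else x.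

Lemma ext_fun_in {k m : nat} (h : 'I_k -> 'I_m) (h_inj : injective h) u i :
  ext_fun h u (h i) = h (u i).
Proof.
rewrite /ext_fun; case: pickP => [j /eqP/h_inj -> //|/(_ i)].
by rewrite eqxx.
Qed.

Lemma ext_fun_out {k m : nat} (h : 'I_k -> 'I_m) u x :
  (forall i, h i != x) -> ext_fun h u x = x.
Proof.
by move=> out; rewrite /ext_fun; case: pickP => // i; rewrite (negPf (out i)).
Qed.

Lemma ext_fun_inj {k m : nat} {h : 'I_k -> 'I_m} (h_inj : injective h) u :
  injective (ext_fun h u).
Proof.
apply: (can_inj (g := ext_fun h (u^-1)%g)) => x.
case: (pickP [pred i | h i == x]) => [i /eqP <-|out].
  by rewrite !ext_fun_in // permK.
by rewrite !ext_fun_out // => i; rewrite (negbT (out i)).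
Qed.

Definition ext {k m : nat} {h : 'I_k -> 'I_m} (h_inj : injective h) (u : 'S_k) :
  'S_m := perm (ext_fun_inj h_inj u).

(** In a product the left factor acts first, so multiplying by [ext h_inj u] on the left permutes
    the entries at the positions [h] among themselves. *)
Lemma pat_ext {k m : nat} {h : 'I_k -> 'I_m} (h_inj : injective h) u s :
  pat h_inj (ext h_inj u * s)%g = (u * pat h_inj s)%g.
Proof.
apply: perm_ltn_inj => i j.
by rewrite ltn_pat !permM ltn_pat !permE !ext_fun_in.
Qed.

(** * Uniform probability on permutations, and independence *)

Definition pr {m : nat} (P : pred 'S_m) : rat := #|P|%:R / (m`!)%:R.

Lemma fact_neq0 (m : nat) : (m`!)%:R != 0 :> rat.
Proof. by rewrite pnatr_eq0 -lt0n fact_gt0. Qed.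

Lemma eq_pr {m : nat} (P Q : pred 'S_m) : P =1 Q -> pr P = pr Q.
Proof. by move=> eq_PQ; rewrite /pr (eq_card eq_PQ). Qed.

Lemma pr_sub {m : nat} (P Q : pred 'S_m) : subpred P Q -> pr P <= pr Q.
Proof.
move=> sub_PQ; rewrite ler_pM2r ?invr_gt0 ?ltr0n ?fact_gt0 // ler_nat.
by apply: subset_leq_card; apply/subsetP.
Qed.

Lemma prT {m : nat} : pr (fun _ : 'S_m => true) = 1.
Proof.
rewrite /pr (_ : #|_| = m`!) ?divff ?fact_neq0 //.
by rewrite -card_Sn; apply: eq_card => s; rewrite !inE.
Qed.

Lemma pr_split {m : nat} (P Q : pred 'S_m) :
  pr P = pr (fun s => P s && Q s) + pr (fun s => P s && ~~ Q s).
Proof.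
rewrite /pr -mulrDl -natrD; congr (_%:R / _).
rewrite -(cardID Q P); congr (_ + _)%N; apply: eq_card => s //.
by rewrite !inE andbC.
Qed.

Lemma pr_or {m : nat} (P Q : pred 'S_m) : pr (fun s => P s || Q s) <= pr P + pr Q.
Proof.
rewrite (pr_split _ P); apply: lerD; apply: pr_sub => s /andP[] //.
by move=> /orP[->|].
Qed.

Lemma pr_has {m : nat} {I : Type} (r : seq I) (P : I -> pred 'S_m) :
  pr (fun s => has (fun i => P i s) r) <= \sum_(i <- r) pr (P i).
Proof.
elim: r => [|i r IHr]; first by rewrite big_nil /pr eq_card0 ?mul0r.
by rewrite big_cons; apply: le_trans (pr_or _ _) _; rewrite lerD2l.
Qed.

(* Averaging over the permutations ext u, which preserve Q, makes the relative
   order of the entries at the positions h uniform for each fixed s. *)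
Lemma pr_pat_indep {k m : nat} {h : 'I_k -> 'I_m} (h_inj : injective h)
    (P : pred 'S_k) (Q : pred 'S_m) :
  (forall u s, Q (ext h_inj u * s)%g = Q s) ->
  pr (fun s => P (pat h_inj s) && Q s) = pr P * pr Q.
Proof.
move=> Q_inv.
have card_sum (j : nat) (R : pred 'S_j) : #|R| = (\sum_(s : 'S_j) R s)%N.
  rewrite -sum1_card big_mkcond; apply: eq_bigr => s _.
  by case: ifP; rewrite unfold_in => ->.
have: (k`! * #|fun s => P (pat h_inj s) && Q s| = #|Q| * #|P|)%N.
  rewrite -card_Sn -sum_nat_const.
  transitivity (\sum_(u : 'S_k) \sum_(s : 'S_m) (P (u * pat h_inj s)%g && Q s))%N.
    apply: eq_bigr => u _; rewrite card_sum (reindex_inj (mulgI (ext h_inj u))).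
    by apply: eq_bigr => s _; rewrite pat_ext Q_inv.
  rewrite exchange_big /= !card_sum big_distrl /=; apply: eq_bigr => s _.
  rewrite [in RHS](reindex_inj (mulIg (pat h_inj s))) big_distrr /=.
  by apply: eq_bigr => u _; rewrite andbC mulnb.
move=> /(congr1 (fun z => z%:R : rat)); rewrite !natrM /pr => eq_PQ.
rewrite mulf_div [_%:R * _ in RHS]mulrC -eq_PQ -mulf_div divff ?fact_neq0 //.
by rewrite mul1r.
Qed.


(** * Occurrences inside and outside a block of positions *)

Lemma nth_word {m : nat} (s : 'S_m) (x : 'I_m) : nth 0%N (word s) x = s x.
Proof. by rewrite /word (nth_map x) ?size_enum_ord // nth_ord_enum. Qed.

Lemma eq_occurs_at {d : nat} (v : 'S_d) {m m' : nat} (s : 'S_m) (t : 'S_m') i j :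
  (i + d <= m)%N -> (j + d <= m')%N ->
  (forall (p q : 'I_d) (x y : 'I_m) (x' y' : 'I_m'),
     x = (i + p)%N :> nat -> y = (i + q)%N :> nat ->
     x' = (j + p)%N :> nat -> y' = (j + q)%N :> nat ->
     (s x < s y)%N = (t x' < t y')%N) ->
  occurs_at v s i = occurs_at v t j.
Proof.
move=> le_im le_jm eq_st; apply: eq_forallb => p; apply: eq_forallb => q.
have lt_i (r : 'I_d) : (i + r < m)%N by have := ltn_ord r; lia.
have lt_j (r : 'I_d) : (j + r < m')%N by have := ltn_ord r; lia.
have := eq_st p q (Ordinal (lt_i p)) (Ordinal (lt_i q))
  (Ordinal (lt_j p)) (Ordinal (lt_j q)) erefl erefl erefl erefl.
by rewrite -!nth_word /= => ->.
Qed.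

Lemma offset_lt {o k m : nat} (le_okm : (o + k <= m)%N) (i : 'I_k) : (o + i < m)%N.
Proof. by have := ltn_ord i; lia. Qed.

Definition offset {o k m : nat} (le_okm : (o + k <= m)%N) (i : 'I_k) : 'I_m :=
  Ordinal (offset_lt le_okm i).

Lemma offset_inj {o k m : nat} (le_okm : (o + k <= m)%N) : injective (offset le_okm).
Proof. by move=> i j /(congr1 val)/addnI/val_inj. Qed.

Lemma occurs_at_pat {d : nat} (v : 'S_d) {o k m : nat} (le_okm : (o + k <= m)%N)
    (s : 'S_m) j :
  (j + d <= k)%N ->
  occurs_at v (pat (offset_inj le_okm) s) j = occurs_at v s (o + j).
Proof.
move=> le_jk; apply: eq_occurs_at; rewrite // -?addnA; first by lia.
move=> p q x y x' y' xE yE x'E y'E; rewrite ltn_pat.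
by congr (s _ < s _)%N; apply: val_inj => /=; lia.
Qed.

Lemma occurs_at_ext {d : nat} (v : 'S_d) {o k m : nat} (le_okm : (o + k <= m)%N)
    (u : 'S_k) (s : 'S_m) j :
  (j + d <= o)%N ->
  occurs_at v (ext (offset_inj le_okm) u * s)%g j = occurs_at v s j.
Proof.
move=> le_jo; apply: eq_occurs_at; [lia | lia |].
have extE (p : 'I_d) (x x' : 'I_m) : x = (j + p)%N :> nat -> x' = (j + p)%N :> nat ->
    ext (offset_inj le_okm) u x = x'.
  move=> xE x'E; rewrite permE ext_fun_out; first by apply: val_inj; rewrite /= xE.
  by move=> i; rewrite -val_eqE /=; have := ltn_ord p; lia.
move=> p q x y x' y' xE yE x'E y'E.
by rewrite !permM (extE p x x') // (extE q y y').
Qed.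

(** An arbitrary interval of window starts is allowed, so that conditions on separate stretches of
    the word can be split off and moved to a block. *)
Definition free {d : nat} (v : 'S_d) (i j : nat) {m : nat} (s : 'S_m) : bool :=
  all (fun t => ~~ occurs_at v s t) (index_iota i j).

Lemma freeP {d : nat} (v : 'S_d) i j {m : nat} (s : 'S_m) :
  reflect (forall t, (i <= t < j)%N -> ~~ occurs_at v s t) (free v i j s).
Proof.
by apply: (iffP allP) => fr t; have := fr t; rewrite mem_index_iota.
Qed.

Lemma free_cat {d : nat} (v : 'S_d) {i j k m : nat} (s : 'S_m) :
  (i <= j <= k)%N -> free v i k s = free v i j s && free v j k s.
Proof.
case/andP=> le_ij le_jk; rewrite /free -all_cat.
by rewrite /index_iota -{2}(subnKC le_ij) -iotaD; congr (all _ (iota _ _)); lia.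
Qed.

Lemma free_last {d : nat} (v : 'S_d) j {m : nat} (s : 'S_m) :
  free v j j.+1 s = ~~ occurs_at v s j.
Proof. by rewrite /free /index_iota subSnn /= andbT. Qed.

(** The last window starts at [j - 1], so it fits in a block of length [k] as soon as
    [j + d <= k.+1]. *)
Lemma free_pat {d : nat} (v : 'S_d) {o k m : nat} (le_okm : (o + k <= m)%N)
    (s : 'S_m) i j :
  (j + d <= k.+1)%N ->
  free v i j (pat (offset_inj le_okm) s) = free v (o + i) (o + j) s.
Proof.
move=> le_jk; rewrite /free /index_iota iotaDl subnDl all_map.
apply: eq_in_all => t; rewrite mem_iota => lt_t /=.
by rewrite occurs_at_pat //; lia.
Qed.

(** The windows end before position [o], where the rearranged block begins. *)
Lemma free_ext {d : nat} (v : 'S_d) {o k m : nat} (le_okm : (o + k <= m)%N)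
    (u : 'S_k) (s : 'S_m) i j :
  (j + d <= o.+1)%N ->
  free v i j (ext (offset_inj le_okm) u * s)%g = free v i j s.
Proof.
move=> le_jo; apply: eq_in_all => t; rewrite mem_index_iota => lt_t.
by rewrite occurs_at_ext //; lia.
Qed.

(** * The numbers [a] as probabilities *)

Lemma avoids_free {d : nat} (v : 'S_d) (m : nat) (s : 'S_m) :
  avoids v s = free v 0 (m.+1 - d) s.
Proof.
rewrite /avoids negb_exists.
apply/forallP/freeP => [av t lt_t|fr t]; last by apply: fr; rewrite ltn_ord.
exact: (av (Ordinal (lt_t : (t < _)%N))).
Qed.

Lemma aE (d : nat) (v : 'S_d) (n : nat) :
  (0 < d)%N -> a v n = pr (fun s : 'S_(n + d - 1) => free v 0 n s).
Proof.
move=> d_gt0; rewrite /a /g0 /pr; congr (_%:R / _).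
apply: eq_card => s; rewrite inE avoids_free unfold_in /=.
by rewrite (_ : (n + d - 1).+1 - d = n)%N //; lia.
Qed.

(** This is independence from the sure event. *)
Lemma pr_pat {k m : nat} {h : 'I_k -> 'I_m} (h_inj : injective h) (P : pred 'S_k) :
  pr (fun s => P (pat h_inj s)) = pr P.
Proof.
rewrite -[RHS]mulr1 -(@prT m) -(pr_pat_indep h_inj) //.
by apply: eq_pr => s; rewrite andbT.
Qed.

(** The first [n] windows only see the first [n + d - 1] entries, whose pattern is uniform. All
    events can thus live in one symmetric group. *)
Lemma pr_free (d : nat) (v : 'S_d) (n m : nat) :
  (0 < d)%N -> (n + d - 1 <= m)%N -> pr (fun s : 'S_m => free v 0 n s) = a v n.
Proof.
move=> d_gt0 le_m; rewrite (@aE _ _ n) // -(pr_pat (@offset_inj 0 _ _ le_m)).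
by apply: eq_pr => s; rewrite free_pat ?add0n //; lia.
Qed.

Lemma pr_first_occurs (d : nat) (v : 'S_d) (n m : nat) :
  (0 < d)%N -> (n + d <= m)%N ->
  pr (fun s : 'S_m => free v 0 n s && occurs_at v s n) = a v n - a v n.+1.
Proof.
move=> d_gt0 le_m; rewrite -(@pr_free _ v n m) -?(@pr_free _ v n.+1 m) //; try lia.
rewrite (pr_split (free v 0 n) (fun s => occurs_at v s n)).
suff -> : pr (fun s : 'S_m => free v 0 n s && ~~ occurs_at v s n)
    = pr (fun s : 'S_m => free v 0 n.+1 s) by rewrite addrK.
by apply: eq_pr => s; rewrite (@free_cat _ v 0 n n.+1) ?free_last //; lia.
Qed.

(** Among the permutations of size [d], only [v] itself qualifies. *)
Lemma pr_occurs_at0 {d : nat} (v : 'S_d) :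
  pr (fun s : 'S_d => occurs_at v s 0) = 1 / (d`!)%:R.
Proof.
rewrite /pr; congr (_ / _); transitivity (#|pred1 v|%:R : rat); last by rewrite card1.
congr _%:R; apply: eq_card => s.
rewrite [RHS]inE; apply/idP/eqP => [/forallP occ|->].
  apply: perm_ltn_inj => i j; have /forallP/(_ j)/eqP := occ i.
  by rewrite !add0n !nth_word.
by apply/forallP=> i; apply/forallP=> j; rewrite !add0n !nth_word.
Qed.

Theorem theorem4 (d : nat) (d_gt0 : (0 < d)%N) (v : 'S_d)
    (l : nat) (l_ge2 : (2 <= l)%N) (n : nat) (n_gt : (l + 2 * d < n)%N) :
  0 <= a v n - a v (n - 1) + beta v (l - 1) * a v (n - l - d + 1)
    <= (d%:R - 1) / (d`!)%:R * a v (n - l - 2 * d + 2).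
Proof.
(* Window [i0 - 1] ends at position [n - l - 1], just before the block that [last_occ] looks at. *)
pose M := (n + d - 1)%N; pose i0 := (n - l - d + 1)%N.
pose last_occ (s : 'S_M) := free v (n - l) (n - 1) s && occurs_at v s (n - 1).
pose F (s : 'S_M) := free v 0 (n - 1) s && occurs_at v s (n - 1).
pose G (s : 'S_M) := last_occ s && free v 0 i0 s.
have prF : pr F = a v (n - 1) - a v n.
  by rewrite pr_first_occurs /M //; first congr (_ - a v _); lia.
have prG : pr G = beta v (l - 1) * a v i0.
  (* The block consists of the last [l + d - 1] positions; inside it [last_occ] says that the first
     occurrence is at window [l - 1]. *)
  have le_M : (n - l + (l + d - 1) <= M)%N by rewrite /M; lia.
  rewrite /beta -(@pr_first_occurs _ v (l - 1) (l + d - 1)) //; last by lia.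
  rewrite -(@pr_free _ v i0 M) //; last by rewrite /M /i0; lia.
  rewrite -(pr_pat_indep (offset_inj le_M)) => [|u s]; last first.
    by rewrite free_ext //; rewrite /i0; lia.
  apply: eq_pr => s; rewrite free_pat ?occurs_at_pat;
    [|lia|lia].
  by rewrite /G /last_occ addn0 (_ : (n - l + (l - 1) = n - 1)%N); last lia.
have FG : subpred F G.
  move=> s /andP[fr occ]; rewrite /G /last_occ occ andbT.
  by apply/andP; split; apply/freeP=> t lt_t; apply: (freeP _ _ _ _ fr);
    rewrite /i0 in lt_t; lia.
have -> : a v n - a v (n - 1) + beta v (l - 1) * a v i0
    = pr (fun s => G s && ~~ F s).
  have : pr (fun s => G s && F s) = pr F.
    by apply: eq_pr => s; apply: andb_idl; apply: FG.
  by have := pr_split G F; rewrite -prG prF; lra.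
apply/andP; split; first by rewrite /pr divr_ge0 ?ler0n.
(* Here [i1 = i0 - (d - 1)]: window [i1 - 1] ends at position [i0 - 1], hence before every window of
   the gap. *)
pose i1 := (n - l - 2 * d + 2)%N.
apply: (@le_trans _ _
  (pr (fun s => has (fun j => occurs_at v s j && free v 0 i1 s)
    (index_iota i0 (n - l))))).
  apply: pr_sub => s /andP[/andP[/andP[fr occ] fr0]].
  (* Cut the windows before [n - 1] at [i0] and [n - l]. Under [G] the two outer ranges are free, so
     failure of [F] forces an occurrence in the middle one. *)
  rewrite /F occ andbT (@free_cat _ v 0 i0 (n - 1)); last by rewrite /i0; lia.
  rewrite (@free_cat _ v i0 (n - l) (n - 1)) ?fr0 ?fr ?andbT /=; last by rewrite /i0; lia.
  rewrite /free -has_predC => /hasP[t t_in /= /negPn occ_t]; apply/hasP; exists t => //.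
  rewrite occ_t; apply/freeP => t' lt_t'; apply: (freeP _ _ _ _ fr0).
  by rewrite /i0 /i1 in lt_t' *; lia.
apply: le_trans (pr_has _ _) _.
have -> : (d%:R - 1) / (d`!)%:R * a v i1
    = \sum_(j <- index_iota i0 (n - l)) (1 / (d`!)%:R * a v i1).
  rewrite sumr_const_nat (_ : (n - l - i0 = d - 1)%N); last by rewrite /i0; lia.
  by rewrite -[RHS]mulr_natl natrB // !mulrA mulr1.
(* [big_seq] keeps the range of [j], which puts window [j] inside the word and after the first [i1]
   windows. *)
rewrite big_seq [leRHS]big_seq; apply: ler_sum => j; rewrite mem_index_iota => lt_j.
have le_M : (j + d <= M)%N by rewrite /M; lia.
rewrite -(pr_occurs_at0 v) -(@pr_free _ v i1 M) //; last by rewrite /M /i1; lia.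
(* The block is now window [j] alone, and its pattern has to be [v]. *)
rewrite -(pr_pat_indep (offset_inj le_M)) => [|u s]; last first.
  by rewrite free_ext //; rewrite /i1 /i0 in lt_j *; lia.
by apply: pr_sub => s; rewrite occurs_at_pat // addn0.
Qed.
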